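(* Let $M$ be a countable transitive model of $\mathsf{ZF}^-$ and suppose that there exists a global well-order (a well-order of $M$) of order type $\mathrm{Ord}^M$ that is definable over $M$. Then there is a notion of class forcing $\mathbb{P}$ (a partial order definable over $M$) which has two Boolean completions in $M$ that are non-isomorphic, in the sense that there is no isomorphism in $\mathsf{V}$ between them which fixes $\mathbb{P}$.
   Context: We work in a model $\mathsf{V}$ of $\mathsf{ZFC}$. $\mathsf{ZF}^-$ denotes the axioms of $\mathsf{ZF}$ without the power set axiom and with Collection instead of Replacement. $\mathrm{Ord}^M$ is the class of ordinals of $M$. ''Definable over $M$'' means first-order definable over $\langle M,\in\rangle$, parameters from $M$ being allowed; a partial order is definable over $M$ if both its domain (a subset of $M$) and its order relation are. A Boolean algebra $\mathbb{B}$ is definable over $M$ if its domain and all its Boolean operations are definable over $M$; such a $\mathbb{B}$ is $M$-complete if $\sup_{\mathbb{B}}A$ exists in $\mathbb{B}$ for every $A\subseteq\mathbb{B}$ with $A\in M$. A Boolean completion of $\mathbb{P}$ in $M$ is an $M$-complete Boolean algebra $\mathbb{B}$ together with an injective dense embedding $\pi$ of $\mathbb{P}$ into $\mathbb{B}\setminus\{0_{\mathbb{B}}\}$ (an injective map with $p\leq q\Leftrightarrow\pi(p)\leq\pi(q)$ whose range is dense in $\mathbb{B}\setminus\{0_{\mathbb{B}}\}$) such that both $\mathbb{B}$ and $\pi$ are definable over $M$. An isomorphism $f:\mathbb{B}_0\to\mathbb{B}_1$ between Boolean completions with embeddings $\pi_0,\pi_1$ fixes $\mathbb{P}$ if $f(\pi_0(p))=\pi_1(p)$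 for all $p\in\mathbb{P}$. *)

(* Defs.v *)
Set Implicit Arguments.
Unset Strict Implicit.
Unset Printing Implicit Defensive.

(** * Structures for the language of set theory *)

Record eps_structure := EpsStructure {
  carrier :> Type;
  elem : carrier -> carrier -> Prop
}.

Declare Scope eps_scope.
Notation "x '∈' y" := (elem x y) (at level 70, no associativity) : eps_scope.
Open Scope eps_scope.

(** The structure ⟨X, ∈⟩, for a set [X] of [V]. *)
Definition restrict (V : eps_structure) (X : V) : eps_structure :=
  @EpsStructure {x : V | x ∈ X} (fun x y => proj1_sig x ∈ proj1_sig y).

Definition val (V : eps_structure) (X : V) (x : restrict X) : V := proj1_sig x.

(** ** First-order formulas (de Bruijn indices) and definability *)

Inductive formula : Type :=
| Mem (i j : nat)
| Eq (i j : nat)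
| Neg (phi : formula)
| And (phi psi : formula)
| Ex (phi : formula).

Definition scons (A : Type) (x : A) (e : nat -> A) (n : nat) : A :=
  match n with O => x | S k => e k end.

Fixpoint sat (A : eps_structure) (phi : formula) (e : nat -> A) : Prop :=
  match phi with
  | Mem i j => e i ∈ e j
  | Eq i j => e i = e j
  | Neg phi => ~ sat phi e
  | And phi psi => sat phi e /\ sat psi e
  | Ex phi => exists x : A, sat phi (scons x e)
  end.

(** Definability with parameters: a formula has finitely many free variables,
    so only finitely many values of [e] are relevant. *)
Definition definable1 (A : eps_structure) (P : A -> Prop) : Prop :=
  exists (phi : formula) (e : nat -> A),
    forall x, P x <-> sat phi (scons x e).

Definition definable2 (A : eps_structure) (R : A -> A -> Prop) : Prop :=
  exists (phi : formula) (e : nat -> A),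
    forall x y, R x y <-> sat phi (scons x (scons y e)).

Definition definable3 (A : eps_structure) (R : A -> A -> A -> Prop) : Prop :=
  exists (phi : formula) (e : nat -> A),
    forall x y z, R x y z <-> sat phi (scons x (scons y (scons z e))).

(** ** Axioms *)

Definition empty_set (A : eps_structure) (x : A) : Prop :=
  forall z : A, ~ z ∈ x.

Definition successor (A : eps_structure) (x s : A) : Prop :=
  forall z : A, z ∈ s <-> z ∈ x \/ z = x.

Definition inductive_set (A : eps_structure) (w : A) : Prop :=
  (exists z : A, empty_set z /\ z ∈ w) /\
  (forall x : A, x ∈ w -> exists s : A, successor x s /\ s ∈ w).

Definition extensionality (A : eps_structure) : Prop :=
  forall x y : A, (forall z : A, z ∈ x <-> z ∈ y) -> x = y.

Definition foundation (A : eps_structure) : Prop :=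
  forall x : A, (exists y : A, y ∈ x) ->
    exists y : A, y ∈ x /\ ~ (exists z : A, z ∈ x /\ z ∈ y).

Definition pairing (A : eps_structure) : Prop :=
  forall x y : A, exists z : A, forall w : A, w ∈ z <-> w = x \/ w = y.

Definition union (A : eps_structure) : Prop :=
  forall x : A, exists u : A,
    forall z : A, z ∈ u <-> exists y : A, y ∈ x /\ z ∈ y.

Definition infinity (A : eps_structure) : Prop :=
  exists w : A, inductive_set w.

Definition separation (A : eps_structure) : Prop :=
  forall (phi : formula) (e : nat -> A) (a : A), exists b : A,
    forall x : A, x ∈ b <-> x ∈ a /\ sat phi (scons x e).

Definition collection (A : eps_structure) : Prop :=
  forall (phi : formula) (e : nat -> A) (a : A),
    (forall x : A, x ∈ a -> exists y : A, sat phi (scons x (scons y e))) ->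
    exists b : A, forall x : A, x ∈ a ->
      exists y : A, y ∈ b /\ sat phi (scons x (scons y e)).

Definition replacement (A : eps_structure) : Prop :=
  forall (phi : formula) (e : nat -> A) (a : A),
    (forall x : A, x ∈ a -> exists! y : A, sat phi (scons x (scons y e))) ->
    exists b : A, forall y : A,
      y ∈ b <-> exists x : A, x ∈ a /\ sat phi (scons x (scons y e)).

Definition power_set (A : eps_structure) : Prop :=
  forall x : A, exists p : A,
    forall y : A, y ∈ p <-> (forall z : A, z ∈ y -> z ∈ x).

Definition choice (A : eps_structure) : Prop :=
  forall x : A,
    (forall y : A, y ∈ x -> exists z : A, z ∈ y) ->
    (forall y y' z : A, y ∈ x -> y' ∈ x -> z ∈ y -> z ∈ y' -> y = y') ->
    exists c : A, forall y : A, y ∈ x -> exists! z : A, z ∈ y /\ z ∈ c.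

Definition ZFminus (A : eps_structure) : Prop :=
  extensionality A /\ foundation A /\ pairing A /\ union A /\ infinity A /\
  separation A /\ collection A.

Definition ZFC (A : eps_structure) : Prop :=
  extensionality A /\ foundation A /\ pairing A /\ union A /\ infinity A /\
  separation A /\ replacement A /\ power_set A /\ choice A.

(** * Notions evaluated in the universe [V] *)

Definition transitive_set (V : eps_structure) (X : V) : Prop :=
  forall x y : V, x ∈ y -> y ∈ X -> x ∈ X.

(** ** Functions that are elements of [V], between classes of [V] *)

Definition is_upair (V : eps_structure) (p x y : V) : Prop :=
  forall w : V, w ∈ p <-> w = x \/ w = y.

(** Kuratowski pairs: [p] is ⟨x, y⟩. *)
Definition is_opair (V : eps_structure) (p x y : V) : Prop :=
  exists s t : V, is_upair s x x /\ is_upair t x y /\ is_upair p s t.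

(** [f(x) = y] for the set of ordered pairs [f]. *)
Definition app (V : eps_structure) (f x y : V) : Prop :=
  exists p : V, p ∈ f /\ is_opair p x y.

Definition is_function (V : eps_structure) (f : V) (D E : V -> Prop) : Prop :=
  (forall p : V, p ∈ f -> exists x y : V, D x /\ E y /\ is_opair p x y) /\
  (forall x : V, D x -> exists! y : V, app f x y).

Definition is_injection (V : eps_structure) (f : V) (D E : V -> Prop) : Prop :=
  is_function f D E /\
  (forall x x' y : V, app f x y -> app f x' y -> x = x').

Definition is_bijection (V : eps_structure) (f : V) (D E : V -> Prop) : Prop :=
  is_injection f D E /\ (forall y : V, E y -> exists x : V, app f x y).

(** ** Countability *)

Definition is_omega (V : eps_structure) (w : V) : Prop :=
  inductive_set w /\
  (forall v : V, inductive_set v -> forall x : V, x ∈ w -> x ∈ v).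

Definition countable_set (V : eps_structure) (X : V) : Prop :=
  exists w f : V,
    is_omega w /\ is_injection f (fun x => x ∈ X) (fun n => n ∈ w).

(** ** Well-orders and ordinals *)

(** [R] is a strict well-order of the set [X]; the subsets of [X] that must
    have a least element are those of the form [s ∩ X] with [s] in [V]. *)
Definition well_order (V : eps_structure) (X : V)
    (R : restrict X -> restrict X -> Prop) : Prop :=
  (forall x, ~ R x x) /\
  (forall x y z, R x y -> R y z -> R x z) /\
  (forall x y, R x y \/ x = y \/ R y x) /\
  (forall s : V, (exists x : restrict X, val x ∈ s) ->
     exists x : restrict X, val x ∈ s /\
       forall y : restrict X, val y ∈ s -> x = y \/ R x y).

Definition ordinal (V : eps_structure) (a : V) : Prop :=
  transitive_set a /\ well_order (fun x y : restrict a => x ∈ y).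

(** The class Ord^M, for a transitive set [M]. *)
Definition Ord (V : eps_structure) (M : V) (a : V) : Prop :=
  a ∈ M /\ ordinal a.

Definition has_order_type_Ord (V : eps_structure) (M : V)
    (R : restrict M -> restrict M -> Prop) : Prop :=
  exists g : V, is_bijection g (fun x => x ∈ M) (Ord M) /\
    forall (x y : restrict M) (a b : V),
      app g (val x) a -> app g (val y) b -> (R x y <-> a ∈ b).

(** * Class forcing over a structure [A] *)

Record poset (A : eps_structure) := Poset {
  cond : A -> Prop;
  le : A -> A -> Prop      (* only relevant on [cond] *)
}.

Definition partial_order (A : eps_structure) (P : poset A) : Prop :=
  (forall p, cond P p -> le P p p) /\
  (forall p q r, cond P p -> cond P q -> cond P r ->
     le P p q -> le P q r -> le P p r) /\
  (forall p q, cond P p -> cond P q -> le P p q -> le P q p -> p = q).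

Definition definable_poset (A : eps_structure) (P : poset A) : Prop :=
  definable1 (cond P) /\
  definable2 (fun p q => cond P p /\ cond P q /\ le P p q).

Definition class_forcing (A : eps_structure) (P : poset A) : Prop :=
  partial_order P /\ definable_poset P.

(** ** Boolean algebras whose domain is a subclass of [A] *)

Record algebra (A : eps_structure) := Algebra {
  dom : A -> Prop;
  join : A -> A -> A;      (* operations only relevant on [dom] *)
  meet : A -> A -> A;
  compl : A -> A;
  bot : A;
  top : A
}.

Definition closed_algebra (A : eps_structure) (B : algebra A) : Prop :=
  dom B (bot B) /\ dom B (top B) /\
  (forall x, dom B x -> dom B (compl B x)) /\
  (forall x y, dom B x -> dom B y -> dom B (join B x y)) /\
  (forall x y, dom B x -> dom B y -> dom B (meet B x y)).

Definition boolean_laws (A : eps_structure) (B : algebra A) : Prop :=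
  bot B <> top B /\
  (forall x y, dom B x -> dom B y ->
     join B x y = join B y x /\
     meet B x y = meet B y x /\
     join B x (meet B x y) = x /\
     meet B x (join B x y) = x) /\
  (forall x y z, dom B x -> dom B y -> dom B z ->
     join B x (join B y z) = join B (join B x y) z /\
     meet B x (meet B y z) = meet B (meet B x y) z /\
     join B x (meet B y z) = meet B (join B x y) (join B x z) /\
     meet B x (join B y z) = join B (meet B x y) (meet B x z)) /\
  (forall x, dom B x ->
     join B x (compl B x) = top B /\ meet B x (compl B x) = bot B).

Definition boolean_algebra (A : eps_structure) (B : algebra A) : Prop :=
  closed_algebra B /\ boolean_laws B.

(** The constants [bot] and [top] are elements of [A], hence definable from
    themselves as parameters. *)
Definition definable_algebra (A : eps_structure) (B : algebra A) : Prop :=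
  definable1 (dom B) /\
  definable3 (fun x y z => dom B x /\ dom B y /\ z = join B x y) /\
  definable3 (fun x y z => dom B x /\ dom B y /\ z = meet B x y) /\
  definable2 (fun x y => dom B x /\ y = compl B x).

Definition ble (A : eps_structure) (B : algebra A) (x y : A) : Prop :=
  meet B x y = x.

Definition is_sup (A : eps_structure) (B : algebra A) (a s : A) : Prop :=
  dom B s /\
  (forall x : A, x ∈ a -> ble B x s) /\
  (forall t : A, dom B t -> (forall x : A, x ∈ a -> ble B x t) -> ble B s t).

(** For [A = restrict M] with [M] transitive, the elements of [a] in [A] are
    exactly its elements in [V]. *)
Definition set_complete (A : eps_structure) (B : algebra A) : Prop :=
  forall a : A, (forall x : A, x ∈ a -> dom B x) -> exists s : A, is_sup B a s.

(** ** Boolean completions *)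

Definition dense_embedding (A : eps_structure) (P : poset A) (B : algebra A)
    (pi : A -> A) : Prop :=
  (forall p, cond P p -> dom B (pi p) /\ pi p <> bot B) /\
  (forall p q, cond P p -> cond P q -> pi p = pi q -> p = q) /\
  (forall p q, cond P p -> cond P q -> (le P p q <-> ble B (pi p) (pi q))) /\
  (forall b, dom B b -> b <> bot B -> exists p, cond P p /\ ble B (pi p) b).

Definition boolean_completion (A : eps_structure) (P : poset A)
    (B : algebra A) (pi : A -> A) : Prop :=
  boolean_algebra B /\
  definable_algebra B /\
  set_complete B /\
  dense_embedding P B pi /\
  definable2 (fun p b => cond P p /\ b = pi p).

(** ** Isomorphisms in [V] *)

(** A subclass of the structure ⟨M, ∈⟩, seen as a class of [V]. *)
Definition class_in (V : eps_structure) (M : V) (C : restrict M -> Prop)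
    (x : V) : Prop :=
  exists x' : restrict M, val x' = x /\ C x'.

Definition algebra_isomorphism (V : eps_structure) (M : V)
    (B0 B1 : algebra (restrict M)) (f : V) : Prop :=
  is_bijection f (class_in (dom B0)) (class_in (dom B1)) /\
  app f (val (bot B0)) (val (bot B1)) /\
  app f (val (top B0)) (val (top B1)) /\
  (forall x y : restrict M,
     app f (val x) (val y) -> app f (val (compl B0 x)) (val (compl B1 y))) /\
  (forall x x' y y' : restrict M,
     app f (val x) (val y) -> app f (val x') (val y') ->
     app f (val (join B0 x x')) (val (join B1 y y')) /\
     app f (val (meet B0 x x')) (val (meet B1 y y'))).

Definition fixes_forcing (V : eps_structure) (M : V) (P : poset (restrict M))
    (pi0 pi1 : restrict M -> restrict M) (f : V) : Prop :=
  forall p, cond P p -> app f (val (pi0 p)) (val (pi1 p)).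

(* Main.v *)
From Stdlib Require Import ClassicalEpsilon.
Require Import Defs.

Set Implicit Arguments.
Unset Strict Implicit.
Unset Printing Implicit Defensive.

(** Let [P] be a proper class ordered by equality. Any algebra of subclasses
    of [P] that contains the singletons and is closed under complements and
    set-indexed unions is a completion of [P]. Split [P] into two proper
    classes [C] and [P \ C], and take all the subclasses that differ by a set
    from one of [0], [C], [P \ C], [P]. If two such splittings [C0], [C1] are
    independent, then [C0] belongs to the first algebra but not to the second,
    whereas an isomorphism fixing [P] preserves the class of conditions below
    an element.

    Every element of the model codes one member of such an algebra: with
    [u = 0] and [v = {0}] excluded from [P], the memberships of [u] and [v] in
    the code [a] say whether [a] is to be complemented inside [C] and inside
    [P \ C]. The two splittings are [{p | u ∈ p}] and [{p | v ∈ p}]. *)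

(** * First-order expressibility of predicates on assignments *)

Section Expressible.
Variable A : eps_structure.
Implicit Types Q : (nat -> A) -> Prop.

(** Stands in for de Bruijn formulas: [express] finds the formula from the shape of an ordinary
    proposition about [e]. *)
Definition expressible Q : Prop :=
  exists phi, forall e, Q e <-> sat phi e.

Lemma expressible_mem i j : expressible (fun e => e i ∈ e j).
Proof. now exists (Mem i j). Qed.

Lemma expressible_eq i j : expressible (fun e => e i = e j).
Proof. now exists (Eq i j). Qed.

Lemma expressible_not Q : expressible Q -> expressible (fun e => ~ Q e).
Proof.
  intros [phi H]. exists (Neg phi). intros e. simpl. now rewrite H.
Qed.

Lemma expressible_and Q Q' :
  expressible Q -> expressible Q' -> expressible (fun e => Q e /\ Q' e).
Proof.
  intros [phi H] [psi H']. exists (And phi psi).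
  intros e. simpl. now rewrite H, H'.
Qed.

Lemma expressible_ext Q Q' :
  (forall e, Q e <-> Q' e) -> expressible Q -> expressible Q'.
Proof.
  intros HQ [phi H]. exists phi. intros e. now rewrite <- HQ.
Qed.

Lemma expressible_or Q Q' :
  expressible Q -> expressible Q' -> expressible (fun e => Q e \/ Q' e).
Proof.
  intros H H'.
  apply (@expressible_ext (fun e => ~ (~ Q e /\ ~ Q' e))).
  - intros e. destruct (classic (Q e)); tauto.
  - now apply expressible_not, expressible_and; apply expressible_not.
Qed.

Lemma expressible_imp Q Q' :
  expressible Q -> expressible Q' -> expressible (fun e => Q e -> Q' e).
Proof.
  intros H H'.
  apply (@expressible_ext (fun e => ~ Q e \/ Q' e)).
  - intros e. destruct (classic (Q e)); tauto.
  - now apply expressible_or; [apply expressible_not|].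
Qed.

Lemma expressible_iff Q Q' :
  expressible Q -> expressible Q' -> expressible (fun e => Q e <-> Q' e).
Proof.
  intros H H'. now apply expressible_and; apply expressible_imp.
Qed.

(** At [scons x e], index 0 and the shifted tail reduce to [x] and [e], so the hypothesis applies by
    conversion. *)
Lemma expressible_ex (Q : A -> (nat -> A) -> Prop) :
  expressible (fun e => Q (e 0) (fun n => e (S n))) ->
  expressible (fun e => exists x, Q x e).
Proof.
  intros [phi H]. exists (Ex phi). intros e. simpl.
  split; intros [x Hx]; exists x.
  - now apply (H (scons x e)).
  - now apply (H (scons x e)) in Hx.
Qed.

Lemma expressible_all (Q : A -> (nat -> A) -> Prop) :
  expressible (fun e => Q (e 0) (fun n => e (S n))) ->
  expressible (fun e => forall x, Q x e).
Proof.
  intros H.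
  apply (@expressible_ext (fun e => ~ exists x, ~ Q x e)).
  - intros e. split.
    + intros Hn x. apply NNPP. intros Hx. apply Hn. now exists x.
    + intros Ha [x Hx]. now apply Hx.
  - apply expressible_not.
    apply (@expressible_ex (fun x e => ~ Q x e)).
    now apply expressible_not.
Qed.

Lemma separation_expressible (Q : (nat -> A) -> Prop) (e : nat -> A) (a : A) :
  separation A -> expressible Q ->
  exists b : A, forall x, x ∈ b <-> x ∈ a /\ Q (scons x e).
Proof.
  intros Hsep [phi H]. destruct (Hsep phi e a) as [b Hb].
  exists b. intros x. now rewrite Hb, H.
Qed.

End Expressible.

Ltac express := cbv beta;
  lazymatch goal with
  | |- expressible (fun e => e _ ∈ e _) => apply expressible_mem
  | |- expressible (fun e => e _ = e _) => apply expressible_eq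
  | |- expressible (fun e => ~ _) => apply expressible_not; express
  | |- expressible (fun e => _ /\ _) => apply expressible_and; express
  | |- expressible (fun e => _ \/ _) => apply expressible_or; express
  | |- expressible (fun e => _ <-> _) => apply expressible_iff; express
  | |- expressible (fun e => exists x, _) => apply expressible_ex; express
  | |- _ => (apply expressible_imp || apply expressible_all); express
  end.

(** * Elementary set existence in a model of ZF without power set *)

Section Codes.
Variable A : eps_structure.
Hypothesis HA : ZFminus A.

Lemma elem_irrefl_2 (x y : A) : x ∈ y -> y ∈ x -> False.
Proof.
  destruct HA as (_ & Hfound & Hpair & _).
  intros Hxy Hyx. destruct (Hpair x y) as [z Hz].
  destruct (Hfound z) as (w & Hw & Hmin).
  - exists x. apply Hz. now left.
  - apply Hz in Hw. destruct Hw as [-> | ->]; apply Hmin.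
    + exists y. split; [apply Hz; now right | easy].
    + exists x. split; [apply Hz; now left | easy].
Qed.

Lemma adjoin_exists (x y : A) :
  exists z : A, forall w, w ∈ z <-> w ∈ x \/ w = y.
Proof.
  destruct HA as (_ & _ & Hpair & Hunion & _).
  destruct (Hpair y y) as [s Hs], (Hpair x s) as [t Ht].
  destruct (Hunion t) as [z Hz]. exists z. intros w. rewrite Hz. split.
  - intros (r & Hr & Hw). apply Ht in Hr. destruct Hr as [-> | ->].
    + now left.
    + apply Hs in Hw. tauto.
  - intros [Hw | ->].
    + exists x. rewrite Ht. tauto.
    + exists s. rewrite Ht, Hs. tauto.
Qed.

(** Serves complementation, which switches the flags [u] and [v] of a code one after the other. *)
Lemma toggle_exists (a x : A) :
  exists b, (x ∈ b <-> ~ x ∈ a) /\ forall w, w <> x -> (w ∈ b <-> w ∈ a).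
Proof.
  destruct (classic (x ∈ a)) as [Hx | Hx].
  - destruct HA as (_ & _ & _ & _ & _ & Hsep & _).
    destruct (@separation_expressible A (fun e => e 0 <> e 1)
      (fun _ => x) a Hsep) as [b Hb]; [express|].
    exists b. cbn [scons] in Hb. split; [|intros w Hw]; rewrite Hb; tauto.
  - destruct (adjoin_exists a x) as [b Hb].
    exists b. split; [|intros w Hw]; rewrite Hb; tauto.
Qed.

Lemma singleton_exists (p : A) : exists s : A, forall w, w ∈ s <-> w = p.
Proof.
  destruct HA as (_ & _ & Hpair & _). destruct (Hpair p p) as [s Hs].
  exists s. intros w. rewrite Hs. tauto.
Qed.

Definition sing (p : A) : A :=
  proj1_sig (constructive_indefinite_description _ (singleton_exists p)).

Lemma elem_sing (w p : A) : w ∈ sing p <-> w = p.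
Proof.
  unfold sing. now destruct constructive_indefinite_description as [s Hs].
Qed.

(** * The class antichain and its two splittings *)

Variables u v : A.
Hypothesis Hu : empty_set u.
Hypothesis Hv : successor u v.

Definition antichain : poset A := Poset (fun p => p <> u /\ p <> v) eq.

Lemma u_neq_v : u <> v.
Proof. intros E. apply (@Hu u). rewrite E at 2. apply Hv. now right. Qed.

Lemma antichain_class_forcing : class_forcing antichain.
Proof.
  split; [split; [|split]|split]; simpl.
  - easy.
  - intros p q r _ _ _ E. now rewrite E.
  - easy.
  - assert (H : expressible (A := A) (fun e => e 0 <> e 1 /\ e 0 <> e 2))
      by express.
    destruct H as [phi H]. exists phi, (scons u (scons v (fun _ => u))).
    intros x. apply (H (scons x (scons u (scons v (fun _ => u))))).
  - assert (H : expressible (A := A) (fun e =>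
        (e 0 <> e 2 /\ e 0 <> e 3) /\ (e 1 <> e 2 /\ e 1 <> e 3) /\ e 0 = e 1))
      by express.
    destruct H as [phi H]. exists phi, (scons u (scons v (fun _ => u))).
    intros x y. apply (H (scons x (scons y (scons u (scons v (fun _ => u)))))).
Qed.

(** Independence of the splittings [u ∈ p] and [v ∈ p] modulo sets. *)
Lemma condition_outside (s : A) (U W : Prop) :
  exists p : A, cond antichain p /\ ~ p ∈ s /\ (u ∈ p <-> U) /\ (v ∈ p <-> W).
Proof.
  pose proof u_neq_v as Huv.
  (* [t] is [s ∪ {u, v}], and the witness [p] will have [t] as an element: [p ∈ s] would then give
     the cycle [p ∈ t ∈ p]. As [t] is neither [u] nor [v], it does not disturb the two prescribed
     memberships. *)
  destruct (adjoin_exists s u) as [s1 Hs1], (adjoin_exists s1 v) as [t Ht].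
  assert (Htu : t <> u).
  { intros E. apply (@Hu u). rewrite <- E at 2. rewrite Ht, Hs1. tauto. }
  assert (Htv : t <> v).
  { intros E. assert (Hvv : v ∈ v) by (rewrite <- E at 2; apply Ht; tauto).
    apply Hv in Hvv. destruct Hvv as [Hvv | Hvv].
    - now apply (@Hu v).
    - now apply Huv. }
  assert (Hopt : forall (x y : A) (Q : Prop),
             exists z : A, forall w, w ∈ z <-> w ∈ x \/ w = y /\ Q).
  { intros x y Q. destruct (classic Q).
    - destruct (adjoin_exists x y) as [z Hz]. exists z. intros w.
      rewrite Hz. tauto.
    - exists x. tauto. }
  destruct (Hopt u u U) as [x1 H1], (Hopt x1 v W) as [x2 H2].
  destruct (adjoin_exists x2 t) as [p Hp].
  assert (Hpm : forall w, w ∈ p <-> w = u /\ U \/ w = v /\ W \/ w = t).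
  { intros w. rewrite Hp, H2, H1. pose proof (@Hu w). tauto. }
  assert (Htp : t ∈ p) by (apply Hpm; tauto).
  exists p. split; [|split; [|split]].
  - split.
    + intros E. apply (@Hu t). now rewrite <- E.
    + intros E. rewrite E in Htp. apply Hv in Htp.
      destruct Htp as [Htp | Htp]; [now apply (@Hu t) | easy].
  - intros Hps. apply (@elem_irrefl_2 p t); [|easy].
    rewrite Ht, Hs1. tauto.
  - rewrite Hpm. intuition congruence.
  - rewrite Hpm. intuition congruence.
Qed.

(** * Coding subclasses of the antichain by sets *)

Definition flipped (u v c a p : A) : Prop :=
  c ∈ p /\ u ∈ a \/ ~ c ∈ p /\ v ∈ a.

(** The negated equivalence is an exclusive or of membership in [a] and the flag of the half
    containing [p]. The arguments [u v c] shadow the section variables, so that formulas can put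
    [e i] in their place. *)
Definition coded (u v c a p : A) : Prop := ~ (p ∈ a <-> flipped u v c a p).

Section Splitting.
Variable c : A.
Hypothesis Hc : c = u \/ c = v.

Lemma split_outside (s : A) (Q : Prop) :
  exists p, cond antichain p /\ ~ p ∈ s /\ (c ∈ p <-> Q).
Proof.
  destruct (condition_outside s Q Q) as (p & Hp & Hs & HU & HW).
  exists p. destruct Hc as [-> | ->]; tauto.
Qed.

(** Outside the set [a ∪ b] a code reduces to its flags, and both halves have conditions there, so
    the flags agree. Equal flags then cancel in the exclusive or at every condition. *)
Lemma coded_inj (a b : A) :
  (forall p, cond antichain p -> (coded u v c a p <-> coded u v c b p)) ->
  a = b.
Proof.
  intros Hab. unfold coded, flipped in Hab.
  destruct HA as (Hext & _ & Hpair & Hunion & _).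
  destruct (Hpair a b) as [t Ht], (Hunion t) as [s Hs].
  assert (Hout : forall p, ~ p ∈ s -> ~ p ∈ a /\ ~ p ∈ b).
  { intros p Hp. split; intros H; apply Hp, Hs.
    - exists a. split; [apply Ht; now left | easy].
    - exists b. split; [apply Ht; now right | easy]. }
  assert (HU : u ∈ a <-> u ∈ b).
  { destruct (split_outside s True) as (p & Hp & Hps & Hcp).
    specialize (Hab p Hp). destruct (Hout p Hps).
    destruct (classic (u ∈ a)), (classic (u ∈ b)); tauto. }
  assert (HW : v ∈ a <-> v ∈ b).
  { destruct (split_outside s False) as (p & Hp & Hps & Hcp).
    specialize (Hab p Hp). destruct (Hout p Hps).
    destruct (classic (v ∈ a)), (classic (v ∈ b)); tauto. }
  apply Hext. intros p.
  destruct (classic (p = u)) as [-> | Hpu]; [easy|].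
  destruct (classic (p = v)) as [-> | Hpv]; [easy|].
  specialize (Hab p (conj Hpu Hpv)). rewrite HU, HW in Hab.
  fold (flipped u v c b p) in Hab.
  destruct (classic (p ∈ a)), (classic (p ∈ b)),
    (classic (flipped u v c b p)); tauto.
Qed.

(** The flags of the union are the disjunctions of the flags in [X]. They already give the right
    answer outside [⋃X], where no member of [X] contains [p]; corrections are confined to a set, and
    separation supplies them. *)
Lemma sup_exists (X : A) :
  exists s, forall p, cond antichain p ->
    (coded u v c s p <-> exists a, a ∈ X /\ coded u v c a p).
Proof.
  destruct HA as (_ & _ & _ & Hunion & _ & Hsep & _).
  destruct (Hunion X) as [U HU].
  (* The first two disjuncts keep a flag exactly when it lies in [⋃X]. The last is the exclusive or
     of the desired membership and the new flag. *)
  destruct (@separation_expressible A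
    (fun e => e 0 = e 1 \/ e 0 = e 2 \/
       (~ (exists a, a ∈ e 4 /\ coded (e 1) (e 2) (e 3) a (e 0)) <->
          exists a, a ∈ e 4 /\ flipped (e 1) (e 2) (e 3) a (e 0)))
    (scons u (scons v (scons c (scons X (fun _ => u))))) U Hsep) as [s Hs].
  { unfold coded, flipped. express. }
  exists s. cbn [scons] in Hs. intros p [Hpu Hpv].
  assert (HsU : u ∈ s <-> exists a, a ∈ X /\ u ∈ a).
  { rewrite Hs, HU. tauto. }
  assert (HsV : v ∈ s <-> exists a, a ∈ X /\ v ∈ a).
  { rewrite Hs, HU. tauto. }
  assert (Hsf : flipped u v c s p <-> exists a, a ∈ X /\ flipped u v c a p).
  { unfold flipped. rewrite HsU, HsV. split.
    - intros [[Hp (a & Ha & H)] | [Hp (a & Ha & H)]]; exists a; tauto.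
    - intros (a & Ha & [[Hp H] | [Hp H]]); [left | right];
        (split; [easy | now exists a]). }
  unfold coded at 1. rewrite Hsf, Hs, HU.
  set (E := exists a, a ∈ X /\ coded u v c a p) in *.
  set (F := exists a, a ∈ X /\ flipped u v c a p) in *.
  assert (Hb : ~ (exists y, y ∈ X /\ p ∈ y) -> (E <-> F)).
  { intros Hn. unfold E, F, coded. split; intros (a & Ha & H); exists a.
    - split; [easy|]. assert (~ p ∈ a) by (intros ?; apply Hn; now exists a).
      apply NNPP. tauto.
    - split; [easy|]. assert (~ p ∈ a) by (intros ?; apply Hn; now exists a).
      tauto. }
  destruct (classic E), (classic F), (classic (exists y, y ∈ X /\ p ∈ y)); tauto.
Qed.

Lemma join_exists (a b : A) :
  exists s, forall p, cond antichain p ->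
    (coded u v c s p <-> coded u v c a p \/ coded u v c b p).
Proof.
  destruct HA as (_ & _ & Hpair & _).
  destruct (Hpair a b) as [X HX], (sup_exists X) as [s Hs].
  exists s. intros p Hp. rewrite (Hs p Hp). split.
  - intros (x & Hx & H). apply HX in Hx. destruct Hx as [-> | ->]; tauto.
  - intros [H | H]; [exists a | exists b]; rewrite HX; tauto.
Qed.

(** Switching both flags reverses the code on both halves and leaves the membership of conditions in
    [a] alone. *)
Lemma compl_exists (a : A) :
  exists b, forall p, cond antichain p ->
    (coded u v c b p <-> ~ coded u v c a p).
Proof.
  pose proof u_neq_v as Huv.
  destruct (toggle_exists a u) as [a1 [H1 H1']].
  destruct (toggle_exists a1 v) as [b [H2 H2']].
  exists b. intros p [Hpu Hpv].
  assert (Hf : flipped u v c b p <-> ~ flipped u v c a p).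
  { unfold flipped. rewrite H2, (H2' u Huv), H1, (H1' v (not_eq_sym Huv)).
    destruct (classic (c ∈ p)); tauto. }
  unfold coded. rewrite Hf, (H2' p Hpv), (H1' p Hpu).
  destruct (classic (p ∈ a)), (classic (flipped u v c a p)); tauto.
Qed.

(** * The Boolean algebra of codes as a completion of the antichain *)

Definition code_join (a b : A) : A :=
  proj1_sig (constructive_indefinite_description _ (join_exists a b)).

Definition code_compl (a : A) : A :=
  proj1_sig (constructive_indefinite_description _ (compl_exists a)).

Definition code_meet (a b : A) : A :=
  code_compl (code_join (code_compl a) (code_compl b)).

Definition code_algebra : algebra A :=
  Algebra (fun _ => True) code_join code_meet code_compl u (code_compl u).

Lemma coded_join (a b p : A) : cond antichain p ->
  (coded u v c (code_join a b) p <-> coded u v c a p \/ coded u v c b p).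
Proof.
  unfold code_join. destruct constructive_indefinite_description as [s Hs].
  exact (Hs p).
Qed.

Lemma coded_compl (a p : A) : cond antichain p ->
  (coded u v c (code_compl a) p <-> ~ coded u v c a p).
Proof.
  unfold code_compl. destruct constructive_indefinite_description as [s Hs].
  exact (Hs p).
Qed.

Lemma coded_meet (a b p : A) : cond antichain p ->
  (coded u v c (code_meet a b) p <-> coded u v c a p /\ coded u v c b p).
Proof.
  intros Hp. unfold code_meet. rewrite coded_compl, coded_join, !coded_compl by easy.
  destruct (classic (coded u v c a p)), (classic (coded u v c b p)); tauto.
Qed.

Lemma coded_bot (p : A) : ~ coded u v c u p.
Proof.
  unfold coded, flipped. pose proof (@Hu p). pose proof (@Hu u).
  pose proof (@Hu v). tauto.
Qed.

Lemma coded_sing (p q : A) : cond antichain p ->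
  (coded u v c (sing p) q <-> q = p).
Proof.
  intros [Hpu Hpv]. unfold coded, flipped. rewrite !elem_sing.
  destruct (classic (q = p)); intuition congruence.
Qed.

Lemma ble_coded (a b : A) :
  ble code_algebra a b <->
  forall p, cond antichain p -> coded u v c a p -> coded u v c b p.
Proof.
  unfold ble. simpl. split.
  - intros E p Hp Ha. rewrite <- E in Ha. now apply (coded_meet a b Hp) in Ha.
  - intros H. apply coded_inj. intros p Hp. rewrite coded_meet by easy.
    specialize (H p Hp). tauto.
Qed.

(** Recovers the coded class from the order and the embedding alone, the data that an isomorphism
    fixing the forcing respects. *)
Lemma ble_sing (p b : A) : cond antichain p ->
  (ble code_algebra (sing p) b <-> coded u v c b p).
Proof.
  intros Hp. rewrite ble_coded. split.
  - intros H. apply H; [easy|]. now apply coded_sing.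
  - intros H q _ Hq. apply coded_sing in Hq; [now subst q | easy].
Qed.

(** By [coded_inj] each equation may be checked at a single condition, where it is a propositional
    tautology. *)
Lemma code_boolean_algebra : boolean_algebra code_algebra.
Proof.
  assert (Heq : forall a b,
    (forall p, cond antichain p -> (coded u v c a p <-> coded u v c b p)) ->
    a = b) by exact coded_inj.
  split; [easy|]. unfold boolean_laws. simpl.
  split; [|split; [|split]].
  - intros E. destruct (split_outside u True) as (p & Hp & _).
    apply (@coded_bot p). rewrite E at 2.
    apply coded_compl; [easy | apply coded_bot].
  - intros x y _ _. repeat split; apply Heq; intros p Hp;
      repeat rewrite ?coded_join, ?coded_meet by easy; tauto.
  - intros x y z _ _ _. repeat split; apply Heq; intros p Hp;
      repeat rewrite ?coded_join, ?coded_meet by easy; tauto.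
  - intros x _. repeat split; apply Heq; intros p Hp;
      repeat rewrite ?coded_join, ?coded_meet, ?coded_compl by easy;
      pose proof (@coded_bot p); destruct (classic (coded u v c x p)); tauto.
Qed.

(** The operations are picked by description, but by [coded_inj] their pointwise specifications have
    unique solutions and hence define their graphs. *)
Lemma code_definable_algebra : definable_algebra code_algebra.
Proof.
  unfold definable_algebra. simpl.
  (* The parameters follow the free variables: [u], [v], [c] sit at indices 3, 4, 5 for the ternary
     graphs and 2, 3, 4 for the binary one. *)
  set (e := scons u (scons v (scons c (fun _ => u)))).
  split; [|split; [|split]].
  - exists (Eq 0 0), e. simpl. tauto.
  - assert (H : expressible (A := A) (fun e => forall p,
      p <> e 3 /\ p <> e 4 ->
      (coded (e 3) (e 4) (e 5) (e 2) p <->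
       coded (e 3) (e 4) (e 5) (e 0) p \/ coded (e 3) (e 4) (e 5) (e 1) p)))
      by (unfold coded, flipped; express).
    destruct H as [phi H]. exists phi, e. intros x y z. rewrite <- H. split.
    + intros (_ & _ & ->) p Hp. now apply coded_join.
    + intros Hz. split; [easy|]. split; [easy|]. apply coded_inj.
      intros p Hp. rewrite coded_join by easy. now apply Hz.
  - assert (H : expressible (A := A) (fun e => forall p,
      p <> e 3 /\ p <> e 4 ->
      (coded (e 3) (e 4) (e 5) (e 2) p <->
       coded (e 3) (e 4) (e 5) (e 0) p /\ coded (e 3) (e 4) (e 5) (e 1) p)))
      by (unfold coded, flipped; express).
    destruct H as [phi H]. exists phi, e. intros x y z. rewrite <- H. split.
    + intros (_ & _ & ->) p Hp. now apply coded_meet.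
    + intros Hz. split; [easy|]. split; [easy|]. apply coded_inj.
      intros p Hp. rewrite coded_meet by easy. now apply Hz.
  - assert (H : expressible (A := A) (fun e => forall p,
      p <> e 2 /\ p <> e 3 ->
      (coded (e 2) (e 3) (e 4) (e 1) p <-> ~ coded (e 2) (e 3) (e 4) (e 0) p)))
      by (unfold coded, flipped; express).
    destruct H as [phi H]. exists phi, e. intros x y. rewrite <- H. split.
    + intros (_ & ->) p Hp. now apply coded_compl.
    + intros Hz. split; [easy|]. apply coded_inj.
      intros p Hp. rewrite coded_compl by easy. now apply Hz.
Qed.

Lemma code_set_complete : set_complete code_algebra.
Proof.
  intros X _. destruct (sup_exists X) as [s Hs]. exists s.
  split; [easy|]. split.
  - intros a Ha. apply ble_coded. intros p Hp H. apply Hs; [easy|]. now exists a.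
  - intros t _ Ht. apply ble_coded. intros p Hp H. apply Hs in H; [|easy].
    destruct H as (a & Ha & H). specialize (Ht a Ha).
    rewrite ble_coded in Ht. now apply Ht.
Qed.

Lemma code_dense_embedding : dense_embedding antichain code_algebra sing.
Proof.
  split; [|split; [|split]].
  - intros p Hp. split; [easy|]. simpl. intros E. apply (@Hu p).
    rewrite <- E. now apply elem_sing.
  - intros p q Hp Hq E. apply elem_sing. rewrite <- E. now apply elem_sing.
  - intros p q Hp Hq. rewrite ble_sing, coded_sing by easy. simpl. easy.
  (* With no singleton below it, [b] codes the empty class, as does [u], so [b] is zero. *)
  - intros b _ Hb. apply NNPP. intros Hn. apply Hb. simpl. apply coded_inj.
    intros p Hp. pose proof (@coded_bot p).
    assert (~ coded u v c b p).
    { intros H'. apply Hn. exists p. split; [easy|]. now apply ble_sing. }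
    tauto.
Qed.

Lemma code_boolean_completion : boolean_completion antichain code_algebra sing.
Proof.
  split; [apply code_boolean_algebra|].
  split; [apply code_definable_algebra|].
  split; [apply code_set_complete|].
  split; [apply code_dense_embedding|].
  assert (H : expressible (A := A) (fun e =>
    (e 0 <> e 2 /\ e 0 <> e 3) /\ forall w, w ∈ e 1 <-> w = e 0)) by express.
  destruct H as [phi H]. exists phi, (scons u (scons v (fun _ => u))).
  intros p b. rewrite <- H. simpl. split.
  - intros (Hp & ->). split; [easy|]. intros w. apply elem_sing.
  - intros (Hp & Hb). split; [easy|]. destruct HA as (Hext & _).
    apply Hext. intros w. now rewrite elem_sing.
Qed.

End Splitting.

(** * Telling the two algebras apart *)

Lemma coded_splitting :
  exists d, forall p, cond antichain p -> (coded u v u d p <-> u ∈ p).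
Proof.
  (* The code [{u}] sets only the flag of the half [u ∈ p] and contains no condition. *)
  destruct (singleton_exists u) as [d Hd]. exists d. intros p [Hpu Hpv].
  assert (Hvu : v <> u) by (intros E; now apply u_neq_v).
  unfold coded, flipped. rewrite !Hd.
  pose proof (eq_refl u). destruct (classic (u ∈ p)); tauto.
Qed.

(** Two conditions outside [d] that both contain [v] lie in the same half, so [d] treats them alike,
    though only one of them contains [u]. *)
Lemma not_coded_splitting (d : A) :
  ~ forall p, cond antichain p -> (coded u v v d p <-> u ∈ p).
Proof.
  intros H.
  destruct (condition_outside d True True) as (p & Hp & Hpd & HpU & HpW).
  destruct (condition_outside d False True) as (q & Hq & Hqd & HqU & HqW).
  pose proof (H p Hp). pose proof (H q Hq). unfold coded, flipped in *. tauto.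
Qed.

End Codes.

(** * Isomorphisms that are elements of [V] *)

Lemma val_inj (V : eps_structure) (M : V) (x y : restrict M) :
  extensionality (restrict M) -> val x = val y -> x = y.
Proof.
  (* Extensionality in [restrict M] avoids comparing the membership proofs carried by [x] and
     [y]. *)
  intros Hext E. apply Hext. intros z. change (val z ∈ val x <-> val z ∈ val y).
  now rewrite E.
Qed.

Lemma opair_inj_r (V : eps_structure) (q x y x' y' : V) :
  is_opair q x y -> is_opair q x' y' -> y = y'.
Proof.
  intros (s & t & Hs & Ht & Hq) (s' & t' & Hs' & Ht' & Hq').
  assert (Hx : x = x').
  { assert (H : s' = s \/ s' = t) by (apply Hq, Hq'; now left).
    assert (Hxs : x ∈ s') by (destruct H as [-> | ->];
      [apply Hs | apply Ht]; now left).
    apply Hs' in Hxs. tauto. }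
  subst x'.
  assert (Hy : y = x \/ y = y').
  { assert (H : t = s' \/ t = t') by (apply Hq', Hq; now right).
    assert (Hyt : y ∈ t) by (apply Ht; now right).
    destruct H as [-> | ->]; [apply Hs' in Hyt | apply Ht' in Hyt]; tauto. }
  assert (Hy' : y' = x \/ y' = y).
  { assert (H : t' = s \/ t' = t) by (apply Hq, Hq'; now right).
    assert (Hyt : y' ∈ t') by (apply Ht'; now right).
    destruct H as [-> | ->]; [apply Hs in Hyt | apply Ht in Hyt]; tauto. }
  intuition congruence.
Qed.

(** Take the image of [d]: the order is given by meets, which [f] preserves. Functionality of [f]
    gives one direction, injectivity the other. *)
Lemma isomorphism_below (V : eps_structure) (M : V)
    (hext : extensionality (restrict M)) (P : poset (restrict M))
    (B0 B1 : algebra (restrict M)) (pi0 pi1 : restrict M -> restrict M)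
    (f : V) (d : restrict M) :
  algebra_isomorphism B0 B1 f -> fixes_forcing P pi0 pi1 f ->
  (forall p, cond P p -> dom B0 (pi0 p)) -> dom B0 d ->
  exists d' : restrict M, forall p, cond P p ->
    (ble B0 (pi0 p) d <-> ble B1 (pi1 p) d').
Proof.
  intros ([[[Hrel Hfun] Hinj] _] & _ & _ & _ & Hops) Hfix Hdom Hd.
  assert (Hd' : exists d' : restrict M, app f (val d) (val d')).
  { destruct (Hfun (val d)) as (y & Hy & _); [now exists d|].
    destruct Hy as (q & Hq & Hqp).
    destruct (Hrel q Hq) as (x' & y' & _ & (d' & <- & _) & Hqp').
    exists d', q. now rewrite <- (opair_inj_r Hqp Hqp'). }
  destruct Hd' as [d' Hd']. exists d'. intros p Hp.
  pose proof (Hfix p Hp) as Hpp.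
  destruct (Hops _ _ _ _ Hpp Hd') as [_ Hm]. unfold ble. split; intros E.
  - rewrite E in Hm. apply val_inj; [easy|].
    destruct (Hfun (val (pi0 p))) as (y & _ & Hy).
    { exists (pi0 p). split; [easy | now apply Hdom]. }
    now rewrite <- (Hy _ Hm), <- (Hy _ Hpp).
  - rewrite E in Hm. apply val_inj; [easy|]. exact (Hinj _ _ _ Hm Hpp).
Qed.

Theorem theorem1p6 (V : eps_structure) (hV : ZFC V) (M : V)
    (hMcountable : countable_set M)
    (hMtransitive : transitive_set M)
    (hMmodel : ZFminus (restrict M))
    (hMorder : exists R : restrict M -> restrict M -> Prop,
        definable2 R /\ well_order R /\ has_order_type_Ord R) :
  exists P : poset (restrict M),
    class_forcing P /\
    exists (B0 B1 : algebra (restrict M)) (pi0 pi1 : restrict M -> restrict M),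
      boolean_completion P B0 pi0 /\
      boolean_completion P B1 pi1 /\
      ~ (exists f : V,
           algebra_isomorphism B0 B1 f /\ fixes_forcing P pi0 pi1 f).
Proof.
  (* Infinity in the model provides [u = 0] and its successor [v = {0}]. *)
  pose proof hMmodel as (Hext & _ & _ & _ & (w & (u & Hu & Hw) & Hsucc) & _).
  destruct (Hsucc u Hw) as (v & Hv & _).
  exists (antichain u v). split; [now apply antichain_class_forcing|].
  assert (Hcu : u = u \/ u = v) by now left.
  assert (Hcv : v = u \/ v = v) by now right.
  exists (code_algebra hMmodel Hu Hv Hcu), (code_algebra hMmodel Hu Hv Hcv),
    (sing hMmodel), (sing hMmodel).
  split; [now apply code_boolean_completion|].
  split; [now apply code_boolean_completion|].
  intros (f & Hf & Hfix).
  (* [d] codes the class of conditions containing [u] in the first algebra; its image [d'] would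
     code the same class in the second. *)
  destruct (coded_splitting hMmodel Hu Hv) as [d Hd].
  destruct (@isomorphism_below V M Hext _ _ _ _ _ f d Hf Hfix) as [d' Hd'];
    [easy | easy |].
  apply (@not_coded_splitting _ hMmodel u v Hu Hv d').
  intros p Hp. rewrite <- (Hd p Hp), <- (ble_sing hMmodel Hu Hv Hcv d' Hp).
  rewrite <- (Hd' p Hp). now apply ble_sing.
Qed.
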